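(* Let $G=(V,E)$ be a connected graph. Then we have $$\nu(G)\ \ge\ \inf_{\sigma}\lambda_1^\sigma(G)\ \ge\ \frac{1}{(\mathrm{diam}(G)+1)\,|V|},$$ where the infimum is taken over all unbalanced signatures $\sigma:E^{or}(G)\to\{\pm1\}$.
   Context: All graphs $G=(V,E)$ are finite and simple; $x\sim y$ denotes adjacency. $E^{or}(G)$ is the set of ordered pairs $(x,y)$ with $x\sim y$. A magnetic potential is a map $\sigma:E^{or}(G)\to S^1=\{z\in\mathbb{C}:|z|=1\}$ with $\sigma(y,x)=\sigma(x,y)^{-1}$; it is called a signature if it only takes values $\pm1$. A signature is balanced if there is $\tau:V\to\{-1,1\}$ with $\tau(x)^{-1}\sigma(x,y)\tau(y)=1$ for all $(x,y)\in E^{or}(G)$, and unbalanced otherwise. The magnetic Laplacian on functions $f:V\to\mathbb{C}$ is $\Delta^\sigma f(x)=\sum_{y\sim x}(f(x)-\sigma(x,y)f(y))$, and $\lambda_1^\sigma(G)$ is its smallest eigenvalue. The magneto-spectral height is $\nu(G)=\sup_\sigma\lambda_1^\sigma(G)$, over all magnetic potentials. $\mathrm{diam}(G)$ is the diameter in the combinatorial distance.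
   Formalization: The first inequality is stated only for graphs having an unbalanced signature: on a tree there is none and ν(G)=0, so the chain fails there; the second inequality covers every connected graph, with the infimum over the empty set taken as +∞. *)

(* Defs.v *)
From HB Require Import structures.
From mathcomp Require Import all_boot all_order all_algebra.
From mathcomp Require Import complex.
From mathcomp Require Import all_classical all_reals ereal.
Set Implicit Arguments.
Unset Strict Implicit.
Unset Printing Implicit Defensive.
Import Order.TTheory GRing.Theory Num.Theory passmx.
Local Open Scope ring_scope.
Local Open Scope complex_scope.
Local Open Scope classical_set_scope.

(* A finite simple graph on V is a symmetric irreflexive e : rel V; the
   ordered edges are the pairs (x, y) with e x y. *)

Section Graph.
Context {V : finType}.
Variable e : rel V.

Definition connected_graph : Prop :=
  (0 < #|V|)%N /\ (forall x y : V, connect e x y).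

(* Least length of a walk from x to y; the search stops at #|V| - 1, which
   bounds every finite distance (the value #|V| means "not connected"). *)
Definition dist (x y : V) : nat :=
  find (fun n => [exists p : n.-tuple V, path e x p && (last x p == y)])
       (iota 0 #|V|).

Definition diam : nat := (\max_(x : V) \max_(y : V) dist x y)%N.

Lemma distP x y : connect e x y ->
  (exists p : seq V, [/\ path e x p, last x p = y & size p = dist x y]) /\
  (forall p : seq V, path e x p -> last x p = y -> (dist x y <= size p)%N).
Proof.
move=> cxy; rewrite /dist.
set a := (X in find X).
have aP (p : seq V) : path e x p -> last x p = y -> a (size p).
  move=> ep lp; apply/existsP; exists (in_tuple p) => /=.
  by rewrite ep lp eqxx.
have ha : has a (iota 0 #|V|).
  have [p0 ep0 lp0] := connectP cxy; case/shortenP: ep0 lp0 => p ep up _ lp.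
  apply/hasP; exists (size p); last exact: aP ep (esym lp).
  by rewrite mem_iota /= add0n; have := max_card (mem (x :: p)); rewrite (card_uniqP up).
have lt_d : (find a (iota 0 #|V|) < #|V|)%N by rewrite -[ltnRHS](size_iota 0) -has_find.
split; first have := nth_find 0%N ha.
  rewrite nth_iota // add0n => /existsP[p /andP[ep /eqP lp]].
  by exists p; rewrite size_tuple.
move=> p ep lp; rewrite leqNgt; apply/negP => ltp.
have := @before_find _ 0%N a _ _ ltp.
by rewrite nth_iota ?add0n ?aP // (ltn_trans ltp).
Qed.

End Graph.

Section Magnetic.
Context {R : realType} {V : finType}.
Variable e : rel V.
Implicit Types s : V -> V -> R[i].

(* Only the values of s on ordered edges matter, here and below. *)
Definition magnetic_potential s : Prop :=
  forall x y, e x y -> `|s x y| = 1 /\ s y x = (s x y)^-1.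

Definition signature s : Prop :=
  magnetic_potential s /\ (forall x y, e x y -> s x y = 1 \/ s x y = -1).

Definition balanced s : Prop :=
  exists tau : V -> R[i], (forall x, tau x = 1 \/ tau x = -1) /\
    (forall x y, e x y -> (tau x)^-1 * s x y * tau y = 1).

Definition unbalanced_signature s : Prop := signature s /\ ~ balanced s.

(* R[i]^o is R[i] seen as a vector space over itself. *)
Definition magnetic_laplacian s (f : {ffun V -> R[i]^o}) : {ffun V -> R[i]^o} :=
  [ffun x => \sum_(y | e x y) (f x - s x y * f y)].

Lemma magnetic_laplacian_is_linear s : linear (magnetic_laplacian s).
Proof.
move=> a f g; apply/ffunP => x; rewrite !ffunE scaler_sumr -big_split /=.
apply: eq_bigr => y _; rewrite !ffunE /GRing.scale /= mulrDr mulrBr.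
by rewrite mulrCA [RHS]addrACA opprD.
Qed.

HB.instance Definition _ s := GRing.isLinear.Build R[i]
  {ffun V -> R[i]^o} {ffun V -> R[i]^o} _ (magnetic_laplacian s)
  (magnetic_laplacian_is_linear s).

Definition laplacian_eigenvalue s (a : R[i]) : Prop :=
  leigenvalue (linfun (magnetic_laplacian s)) a.

(* The magnetic Laplacian is Hermitian, so its eigenvalues are real; that the
   infimum is the smallest eigenvalue is lambda1P. *)
Definition lambda1 s : R := inf [set l : R | laplacian_eigenvalue s l%:C].

Lemma laplacian_eigenvalueP s a : laplacian_eigenvalue s a <->
  exists2 f : {ffun V -> R[i]^o}, f != 0 & magnetic_laplacian s f = a *: f.
Proof.
rewrite /laplacian_eigenvalue /leigenvalue /leigenspace; split.
  rewrite -vpick0; set f := vpick _ => f0; exists f => //.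
  have := memv_pick (lker (linfun (magnetic_laplacian s) - a *: \1%VF)).
  by rewrite memv_ker add_lfunE opp_lfunE scale_lfunE id_lfunE lfunE subr_eq0 => /eqP.
move=> [f f0 Ef]; apply: contra f0 => /eqP k0.
by rewrite -memv0 -k0 memv_ker add_lfunE opp_lfunE scale_lfunE id_lfunE lfunE /= Ef subrr.
Qed.

Lemma laplacian_eigenvalue_ge0 s a : symmetric e -> magnetic_potential s ->
  laplacian_eigenvalue s a -> 0 <= a.
Proof.
move=> e_sym ms /laplacian_eigenvalueP[f f0 Ef].
have [x0 fx0] : exists x, f x != 0.
  apply/existsP; apply: contraNT f0; rewrite negb_exists => /forallP f0.
  by apply/eqP/ffunP => x; rewrite ffunE; apply/eqP/negPn.
have nf_gt0 : 0 < \sum_x `|f x : R[i]| ^+ 2.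
  rewrite (bigD1 x0) //= ltr_wpDr ?exprn_gt0 ?normr_gt0 //.
  by apply: sumr_ge0 => x _; rewrite exprn_ge0.
have S1 : a * \sum_x `|f x : R[i]| ^+ 2 =
    \sum_x \sum_(y | e x y) ((f x : R[i]) - s x y * f y) * (f x)^*%C.
  rewrite mulr_sumr; apply: eq_bigr => x _.
  have := congr1 (fun g : {ffun V -> R[i]^o} => g x) Ef.
  rewrite -mulr_suml !ffunE => ->.
  by rewrite normCK mulrA.
have S2 : (a * \sum_x `|f x : R[i]| ^+ 2) *+ 2 =
    \sum_x \sum_(y | e x y) `|(f x : R[i]) - s x y * f y| ^+ 2.
  rewrite mulr2n {2}S1 (exchange_big_dep predT) //= S1 -big_split /=.
  apply: eq_bigr => x _.
  under [X in _ + X]eq_bigl do rewrite e_sym.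
  rewrite -big_split /=; apply: eq_bigr => y exy.
  have [n1 ->] := ms _ _ exy.
  have -> : (s x y)^-1 = (s x y)^*%C by rewrite invC_norm n1 expr1n invr1 mul1r.
  rewrite normCK rmorphB rmorphM /=.
  have /= n2 : s x y * (s x y)^*%C = 1 by rewrite -[LHS]normCK n1 expr1n.
  rewrite !mulrBl !mulrBr -!addrA; congr (_ + _).
  rewrite [s x y * f y * (_ * _)]mulrACA n2 mul1r opprB.
  by rewrite addrCA [in RHS]addrCA; congr (_ + _); rewrite addrC; congr (_ - _); rewrite mulrCA mulrA mulrC.
have : 0 <= (a * \sum_x `|f x : R[i]| ^+ 2) *+ 2.
  rewrite S2; apply: sumr_ge0 => x _; apply: sumr_ge0 => y _.
  by rewrite exprn_ge0.
by rewrite pmulrn_lge0 // pmulr_lge0.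
Qed.

Lemma lambda1P s : symmetric e -> magnetic_potential s -> (0 < #|V|)%N ->
  laplacian_eigenvalue s (lambda1 s)%:C /\
  (forall a, laplacian_eigenvalue s a -> (lambda1 s)%:C <= a).
Proof.
move=> e_sym ms V0; pose U := {ffun V -> R[i]^o} : vectType R[i].
set h := linfun (magnetic_laplacian s).
set b := vbasis {:U}.
have bb : basis_of {:U} b by exact: vbasisP.
set p := char_poly (mxof b b h).
have eigE a : laplacian_eigenvalue s a <-> root p a.
  rewrite /laplacian_eigenvalue -/h /leigenvalue (leigenspaceE bb).
  by rewrite (vsof_eq0 bb) -[_ != 0]/(eigenvalue _ a) eigenvalue_root_char.
have [r pE] := closed_field_poly_normal p.
rewrite (eqP (char_poly_monic _)) scale1r in pE.
have rootE a : root p a = (a \in r) by rewrite pE root_prod_XsubC.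
have sz : size p = (\dim {:U}).+1 by exact: size_char_poly.
have dimU : (0 < \dim {:U})%N.
  rewrite lt0n dimv_eq0 -subv0; apply/negP => /subvP sub0.
  have /card_gt0P[x _] := V0.
  have := sub0 [ffun=> 1] (memvf _); rewrite memv0 => /eqP /ffunP/(_ x).
  by rewrite !ffunE => /eqP; rewrite oner_eq0.
have [z0 z0r] : exists z0, z0 \in r.
  move: sz; rewrite pE size_prod_XsubC => -[szr].
  by move: dimU; rewrite -szr; case: (r) => // z ? _; exists z; rewrite mem_head.
have r_ge0 a : a \in r -> 0 <= a.
  by rewrite -rootE => /eigE; apply: laplacian_eigenvalue_ge0.
have [m mr mP] : exists2 m, m \in r & forall a, a \in r -> m <= a.
  have tot : {in r &, total <=%O}.
    by move=> x y /r_ge0 x0 /r_ge0 y0; apply: real_leVge; apply: ger0_real.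
  have : sorted <=%O (sort <=%O r) by apply: (@sort_sorted_in _ (mem r)) => //; apply/allP.
  have memE := mem_sort <=%O r; case E : (sort _ r) memE => [|m t] memE.
    by have := memE z0; rewrite z0r.
  rewrite /= (path_sortedE le_trans) => /andP[/allP mt _].
  exists m => [|a]; first by rewrite -memE mem_head.
  by rewrite -memE inE => /predU1P[->//|/mt].
have mE : (complex.Re m)%:C = m by apply: RRe_real; apply: ger0_real; apply: r_ge0.
suff -> : lambda1 s = complex.Re m.
  rewrite mE; split; first by apply/eigE; rewrite rootE.
  by move=> a /eigE; rewrite rootE => /mP.
have lbm : lbound [set l : R | laplacian_eigenvalue s l%:C] (complex.Re m).
  by move=> l /= /eigE; rewrite rootE => /mP; rewrite -[m in m <= _]mE lecR.
have inm : [set l : R | laplacian_eigenvalue s l%:C] (complex.Re m).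
  by rewrite /= mE; apply/eigE; rewrite rootE.
apply/eqP; rewrite eq_le; apply/andP; split.
  by apply: ge_inf inm; exists (complex.Re m).
by apply: lb_le_inf lbm; exists (complex.Re m).
Qed.

Definition magneto_spectral_height : \bar R :=
  ereal_sup [set (lambda1 s)%:E | s in magnetic_potential].

(* Equal to +oo when the graph has no unbalanced signature. *)
Definition inf_lambda1_unbalanced : \bar R :=
  ereal_inf [set (lambda1 s)%:E | s in unbalanced_signature].

End Magnetic.

Arguments magneto_spectral_height R {V} e.
Arguments inf_lambda1_unbalanced R {V} e.

(* Main.v *)
Require Import Defs.
From mathcomp Require Import all_boot all_order all_algebra.
From mathcomp Require Import complex.
From mathcomp Require Import all_classical all_reals ereal.
From mathcomp Require Import ring lra.
Set Implicit Arguments.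
Unset Strict Implicit.
Unset Printing Implicit Defensive.
Import Order.TTheory GRing.Theory Num.Theory.
Local Open Scope ring_scope.
Local Open Scope complex_scope.

(** The lower bound is a path argument on an eigenfunction [f] of the smallest
    eigenvalue [l].

    Write [w x y = |f x - s x y f y|].  Expanding the Hermitian form of the
    Laplacian gives [l * \sum_x |f x|^2 = 1/2 \sum_(x ~ y) (w x y)^2], so it is
    enough to bound the Dirichlet energy on the right from below by
    [|f x0|^2 / (diam + 1)], where [x0] is a vertex at which [|f|] is maximal:
    then [\sum_x |f x|^2 <= |V| |f x0|^2] and the claim follows.

    Along a walk [p] from [x0] to [v], telescoping bounds
    [|f x0 - h p * f v|] by the sum of [w] over the steps of [p], where [h p] is
    the holonomy of [p], the product of the values of [s] on its steps.  An
    unbalanced signature admits two simple walks [p] and [q] from [x0] to the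
    same vertex, of length at most [diam + 1], whose holonomies are opposite
    ([opposite_walks]): otherwise the holonomy of geodesics from [x0] would be a
    switching function that balances [s].  Adding the two telescoped bounds
    cancels [f v] and leaves [2 |f x0|], so the sum of [w] over one of the two
    walks is at least [|f x0|].  By Cauchy-Schwarz that walk alone carries
    energy at least [|f x0|^2 / (diam + 1)]; being simple, it uses no edge
    twice, and the total energy is at least as large ([pointwise_poincare]).

    The comparison with the magneto-spectral height holds because any unbalanced
    signature is itself a magnetic potential. *)

(** * Geodesics *)

Lemma simple_geodesic (V : finType) (e : rel V) (x y : V) : connect e x y ->
  exists p, [/\ path e x p, uniq (x :: p), last x p = y & size p = dist e x y].
Proof.
move=> /distP[[p [ep lp sp]] dmin].
(* Deleting the loops of a geodesic cannot shorten it, by minimality. *)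
case/shortenP: ep lp => q eq uq qp lq.
exists q; split=> //; apply/eqP; rewrite eqn_leq dmin // andbT -sp.
by apply: uniq_leq_size => //; case/andP: uq.
Qed.

Lemma leq_dist_diam (V : finType) (e : rel V) (x y : V) :
  (dist e x y <= diam e)%N.
Proof.
apply: leq_trans (leq_bigmax (F := fun x => \max_y dist e x y)%N x).
exact: (leq_bigmax (F := dist e x) y).
Qed.

(** * Sums along walks *)

(** Both orientations of each step are listed, so that for a simple walk this is
    a duplicate-free part of the index set of a sum over ordered edges. *)
Fixpoint darts (V : Type) (x : V) (p : seq V) : seq (V * V) :=
  if p is y :: q then [:: (x, y), (y, x) & darts y q] else [::].

Fixpoint walk_sum (V : Type) (A : nmodType) (w : V -> V -> A) (x : V)
    (p : seq V) : A :=
  if p is y :: q then w x y + walk_sum w y q else 0.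

Fixpoint holonomy (V : Type) (A : pzSemiRingType) (s : V -> V -> A) (x : V)
    (p : seq V) : A :=
  if p is y :: q then s x y * holonomy s y q else 1.

Lemma holonomy_rcons (V : Type) (A : pzSemiRingType) (s : V -> V -> A) x p y :
  holonomy s x (rcons p y) = holonomy s x p * s (last x p) y.
Proof. by elim: p x => [|z p IH] x /=; rewrite ?mulr1 ?mul1r// IH mulrA. Qed.

Lemma mem_darts (V : eqType) (x : V) p d :
  d \in darts x p -> (d.1 \in x :: p) && (d.2 \in x :: p).
Proof.
elim: p x => [//|y p IH] x; rewrite /= !inE => /or3P[/eqP->|/eqP->|/IH] /=.
- by rewrite !eqxx orbT.
- by rewrite !eqxx orbT.
by rewrite !inE => /andP[-> ->]; rewrite !orbT.
Qed.

Lemma darts_uniq (V : eqType) (x : V) p : uniq (x :: p) -> uniq (darts x p).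
Proof.
elim: p x => [//|y p IH] x /= /andP[xNp up].
rewrite IH // andbT inE xpair_eqE negb_or.
have xy : x != y by apply: contraNneq xNp => ->; rewrite mem_head.
rewrite negb_and xy /=.
by apply/andP; split; apply: contraNN xNp => /mem_darts/andP[].
Qed.

Lemma path_darts (V : eqType) (e : rel V) x p : symmetric e -> path e x p ->
  all (fun d => e d.1 d.2) (darts x p).
Proof.
move=> e_sym; elim: p x => [//|y p IH] x /= /andP[exy /IH ->].
by rewrite [e y x]e_sym exy.
Qed.

(** A simple walk traverses each edge at most once, hence its steps, counted in
    both directions, are distinct terms of the sum over ordered edges. *)
Lemma walk_sum_darts (V : finType) (R : numDomainType) (e : rel V)
    (w : V -> V -> R) (x : V) p :
  symmetric e -> (forall a b, 0 <= w a b) ->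
  (forall a b, e a b -> w a b = w b a) ->
  path e x p -> uniq (x :: p) ->
  walk_sum w x p *+ 2 <= \sum_a \sum_(b | e a b) w a b.
Proof.
move=> e_sym w_ge0 w_sym ep up.
have -> : walk_sum w x p *+ 2 = \sum_(d <- darts x p) w d.1 d.2.
  elim: p x ep {up} => [|y p IH] x /=; first by rewrite big_nil mul0rn.
  move=> /andP[exy ep]; rewrite !big_cons -IH //= -(w_sym _ _ exy).
  by rewrite mulrnDl [w x y *+ 2]mulr2n -addrA.
rewrite big_uniq ?darts_uniq //= pair_big_dep /=.
rewrite [leRHS]big_mkcond [leLHS]big_mkcond; apply: ler_sum => d _ /=.
case: ifPn => [/(allP (path_darts e_sym ep)) /= ->//|_].
by case: ifP.
Qed.

(** This is Cauchy-Schwarz on the steps of a walk.  It is obtained by summing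
    the linearization [K^2 w^2 >= 2 K m w - m^2], that is
    [(K w - m)^2 >= 0], over the at most [K] steps. *)
Lemma walk_sum_sqr (V : finType) (R : realFieldType) (w : V -> V -> R) (x : V)
    p (m K : R) :
  0 < K -> (size p)%:R <= K -> 0 <= m <= walk_sum w x p ->
  m ^+ 2 <= K * walk_sum (fun a b => w a b ^+ 2) x p.
Proof.
move=> K0 pK /andP[m0 mS].
have key : 2 * K * m * walk_sum w x p - (size p)%:R * m ^+ 2 <=
    K ^+ 2 * walk_sum (fun a b => w a b ^+ 2) x p.
  elim: p x {pK mS} => [|y p IH] x /=; first by rewrite !mulr0 mul0r subr0.
  by have := IH y; have := sqr_ge0 (K * w x y - m); rewrite -natr1; nra.
rewrite -(ler_pM2l K0) [leRHS]mulrA -[K * K]expr2; apply: le_trans key.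
have : (size p)%:R * m ^+ 2 <= K * m ^+ 2 by rewrite ler_wpM2r ?sqr_ge0.
have : K * m * m <= K * m * walk_sum w x p by rewrite ler_wpM2l ?mulr_ge0 // ltW.
by nra.
Qed.

(** * Magnetic potentials along walks *)

Section Walks.
Context {R : realType} {V : finType} (e : rel V).
Implicit Types (s : V -> V -> R[i]) (f : V -> R[i]).

Lemma holonomy_telescope s f x p : magnetic_potential e s -> path e x p ->
  `|f x - holonomy s x p * f (last x p)| <=
    walk_sum (fun a b => `|f a - s a b * f b|) x p.
Proof.
move=> ms; elim: p x => [|y p IH] x /=; first by rewrite mul1r subrr normr0.
move=> /andP[exy /IH {IH}]; set S := walk_sum _ _ _; set h := holonomy _ _ _.
set z := f (last y p) => IH.
have -> : f x - s x y * h * z = (f x - s x y * f y) + s x y * (f y - h * z).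
  by ring.
apply: le_trans (ler_normD _ _) _.
by rewrite lerD2l normrM (ms _ _ exy).1 mul1r.
Qed.

Lemma holonomy_sign s x p : signature e s -> path e x p ->
  holonomy s x p = 1 \/ holonomy s x p = -1.
Proof.
move=> [_ sgn]; elim: p x => [|y p IH] x /=; first by left.
by move=> /andP[/sgn[] -> /IH[] ->]; rewrite ?mulN1r ?mul1r ?opprK; tauto.
Qed.

(** If the holonomies [tau] of geodesics from [x] were consistent along every
    edge, [tau] would balance [s]; so some edge [u ~ v] has
    [tau u * s u v = - tau v].  The two walks are the geodesic to [u] prolonged
    by this edge and the geodesic to [v]. *)
Lemma opposite_walks s (x : V) : symmetric e -> irreflexive e ->
  (forall y, connect e x y) -> unbalanced_signature e s ->
  exists p q, [/\ path e x p, path e x q, uniq (x :: p), uniq (x :: q) &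
    [/\ (size p <= (diam e).+1)%N, (size q <= (diam e).+1)%N,
        last x p = last x q & holonomy s x p = - holonomy s x q]].
Proof.
move=> e_sym e_irr conn [sig unb].
have [P PP] := choice (fun y => simple_geodesic (conn y)).
pose tau y := holonomy s x (P y).
have tauP y : tau y = 1 \/ tau y = -1.
  by case: (PP y) => ep _ _ _; apply: holonomy_sign.
have [u [v [euv tau_uv]]] : exists u v, e u v /\ tau u * s u v = - tau v.
  apply: contrapT => none; apply: unb; exists tau; split=> // u v euv.
  have : tau u * s u v <> - tau v by move=> bad; apply: none; exists u, v.
  case: (tauP u) => ->; case: (tauP v) => ->; case: (sig.2 _ _ euv) => ->;
    by rewrite ?invrN ?invr1 ?mulN1r ?mulrN1 ?mulr1 ?opprK.
(* Prolonging the geodesic of the endpoint nearer to x keeps the walk simple;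
   the defect is symmetric in u and v because signs are their own inverses. *)
wlog le_uv : u v euv tau_uv / (dist e x u <= dist e x v)%N.
  move=> H; have [|/ltnW] := leqP (dist e x u) (dist e x v); first exact: H.
  apply: (H v u); first by rewrite e_sym.
  have [_ ->] := sig.1 _ _ euv; move: tau_uv.
  case: (tauP u) => ->; case: (tauP v) => ->; case: (sig.2 _ _ euv) => ->;
    by rewrite ?invrN ?invr1 ?mulN1r ?mulrN1 ?mulr1 ?opprK.
have [epu upu lpu spu] := PP u; have [epv upv lpv spv] := PP v.
(* A geodesic to u through v would make v strictly nearer to x than u. *)
have vNP : v \notin x :: P u.
  apply/negP => vP; move: euv epu spu le_uv.
  move: lpu; case/splitPl: vP => p1 p2 lp1; rewrite last_cat lp1 cat_path.
  case: p2 => [/= ->|z p2 _ _ /andP[ep1 _]]; first by rewrite e_irr.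
  rewrite size_cat /= addnS => <-; apply/negP; rewrite -ltnNge ltnS.
  by apply: leq_trans (leq_addr _ _); apply: (distP (conn v)).2.
exists (rcons (P u) v), (P v); split=> //.
- by rewrite rcons_path epu lpu.
- by rewrite -rcons_cons rcons_uniq vNP.
split; last by rewrite holonomy_rcons lpu.
- by rewrite size_rcons spu ltnS leq_dist_diam.
- by rewrite spv ltnW // ltnS leq_dist_diam.
- by rewrite last_rcons.
Qed.

(** Pair the eigenvalue equation with [f].  For each edge, [s y x] is the
    conjugate of [s x y], so the terms [(f x - s x y * f y) * conj (f x)] of
    its two orientations add up to [`|f x - s x y * f y| ^+ 2]. *)
Lemma dirichlet_energy s (f : {ffun V -> R[i]^o}) (a : R[i]) :
  symmetric e -> magnetic_potential e s ->
  magnetic_laplacian e s f = a *: f ->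
  \sum_x \sum_(y | e x y) `|(f x : R[i]) - s x y * f y| ^+ 2 =
    (a * \sum_x `|f x : R[i]| ^+ 2) *+ 2.
Proof.
move=> e_sym ms Ef.
pose D x y : R[i] := ((f x : R[i]) - s x y * f y) * Num.conj (f x : R[i]).
have sumD : \sum_x \sum_(y | e x y) D x y = a * \sum_x `|f x : R[i]| ^+ 2.
  rewrite mulr_sumr; apply: eq_bigr => x _; rewrite -mulr_suml.
  have := congr1 (fun g : {ffun V -> R[i]^o} => g x) Ef.
  by rewrite !ffunE => ->; rewrite normCK mulrA.
have dE x y : e x y ->
    `|(f x : R[i]) - s x y * f y| ^+ 2 = D x y + D y x.
  move=> /ms [n1]; rewrite invC_norm n1 expr1n invr1 mul1r /D => ->.
  rewrite normCK rmorphB rmorphM /=.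
  have : s x y * Num.conj (s x y) = 1 by have /= <- := normCK (s x y); rewrite n1 expr1n.
  move: (s x y) (Num.conj (s x y)) => z z'; move: (f x : R[i]) (f y : R[i]) => b c zz.
  apply/eqP; rewrite -subr_eq0; apply/eqP.
  (* The two sides differ by a multiple of z * z' - 1. *)
  transitivity ((z * z' - 1) * (c * Num.conj c)); last by rewrite zz subrr mul0r.
  by ring.
rewrite mulr2n -{1}sumD -[X in _ + X]sumD.
rewrite [X in _ + X](exchange_big_dep predT) //= -big_split /=.
apply: eq_bigr => x _.
under [X in _ + X]eq_bigl do rewrite e_sym.
by rewrite -big_split /=; apply: eq_bigr => y /dE.
Qed.

(** For an unbalanced signature a single value of [f] is controlled by the
    differences [`|f x - s x y * f y|], so there is no nonzero parallel section:
    two walks of opposite holonomy force [f x0] to vary along one of them. *)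
Lemma pointwise_poincare s f x0 : symmetric e -> irreflexive e ->
  (forall y, connect e x0 y) -> unbalanced_signature e s ->
  Normc.normc (f x0) ^+ 2 *+ 2 <=
    ((diam e)%:R + 1) *
    \sum_x \sum_(y | e x y) Normc.normc (f x - s x y * f y) ^+ 2.
Proof.
move=> e_sym e_irr conn us; have ms := us.1.1.
pose w x y : R := Normc.normc (f x - s x y * f y).
have wE x y : (w x y)%:C = `|f x - s x y * f y| by [].
have w_ge0 a b : 0 <= w a b by rewrite -lecR wE normr_ge0.
have w_sym a b : e a b -> w a b = w b a.
  move=> eab; apply: complexI; rewrite !wE; have [n1 ->] := ms _ _ eab.
  have s0 : s a b != 0 by rewrite -normr_eq0 n1 oner_eq0.
  rewrite -[LHS]mul1r -[in LHS]invr1 -{1}n1 -normfV -normrM distrC.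
  by rewrite mulrBr mulKf // distrC.
set m := Normc.normc (f x0).
have mE : m%:C = `|f x0| by [].
have m_ge0 : 0 <= m by rewrite -lecR mE normr_ge0.
have [p [q [ep eq up uq [sp sq lpq hpq]]]] := opposite_walks e_sym e_irr conn us.
have walkE x r : (walk_sum w x r)%:C =
    walk_sum (fun a b => `|f a - s a b * f b|) x r.
  by elim: r x => //= y r IH x; rewrite rmorphD /= IH.
have two_walks : m *+ 2 <= walk_sum w x0 p + walk_sum w x0 q.
  rewrite -lecR rmorphMn rmorphD /= !walkE mE -normrMn.
  apply: le_trans
    (lerD (holonomy_telescope f ms ep) (holonomy_telescope f ms eq)).
  apply: le_trans (ler_normD _ _); rewrite lpq hpq mulr2n.
  by rewrite mulNr opprK addrACA subrr addr0.
have K_gt0 : 0 < (diam e)%:R + 1 :> R by rewrite ltr_wpDl.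
have walk_energy r : path e x0 r -> uniq (x0 :: r) ->
    (size r <= (diam e).+1)%N -> m <= walk_sum w x0 r ->
    m ^+ 2 *+ 2 <=
      ((diam e)%:R + 1) * \sum_x \sum_(y | e x y) w x y ^+ 2.
  move=> er ur sr mr.
  apply: (@le_trans _ _
    (((diam e)%:R + 1) * (walk_sum (fun a b => w a b ^+ 2) x0 r *+ 2))).
    rewrite mulrnAr ler_pMn2r //; apply: walk_sum_sqr => //.
      by rewrite natr1 ler_nat.
    by rewrite m_ge0.
  rewrite ler_pM2l //.
  by apply: walk_sum_darts => // [a b|a b /w_sym ->//]; apply: exprn_ge0.
have [mp|mp] := leP m (walk_sum w x0 p); first exact: (walk_energy p).
by apply: (walk_energy q) => //; move: two_walks; rewrite mulr2n; lra.
Qed.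

Lemma lambda1_unbalanced_ge s : symmetric e -> irreflexive e ->
  connected_graph e -> unbalanced_signature e s ->
  1 / (((diam e)%:R + 1) * #|V|%:R) <= lambda1 e s.
Proof.
move=> e_sym e_irr [V0 conn] us; have ms := us.1.1.
have [/laplacian_eigenvalueP[f f0 Ef] _] := lambda1P e_sym ms V0.
set l := lambda1 e s in Ef *.
pose nf x : R := Normc.normc (f x : R[i]).
have nfE x : (nf x)%:C = `|f x : R[i]| by [].
have nf_ge0 a : 0 <= nf a by rewrite -lecR nfE normr_ge0.
have energy : \sum_x \sum_(y | e x y)
    Normc.normc ((f x : R[i]) - s x y * f y) ^+ 2 = (l * \sum_x nf x ^+ 2) *+ 2.
  apply: complexI; rewrite rmorphMn rmorphM !rmorph_sum /=.
  under [X in l%:C * X]eq_bigr do rewrite rmorphXn /= nfE.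
  rewrite -(dirichlet_energy e_sym ms Ef); apply: eq_bigr => x _.
  by rewrite rmorph_sum; apply: eq_bigr => y _; rewrite rmorphXn.
have [x1 _] := card_gt0P V0.
pose x0 := [arg max_(x > x1) nf x]%O.
have x0max y : nf y <= nf x0 by rewrite /x0; case: arg_maxP => // x _; apply.
have m_gt0 : 0 < nf x0.
  rewrite lt_def nf_ge0 andbT; apply: contra f0 => /eqP m0.
  apply/eqP/ffunP => x; rewrite ffunE; apply/eqP; rewrite -normr_eq0 -nfE.
  by rewrite (_ : nf x = 0) //; apply/eqP; rewrite eq_le nf_ge0 -m0 x0max.
have low : nf x0 ^+ 2 <= ((diam e)%:R + 1) * (l * \sum_x nf x ^+ 2).
  rewrite -(@ler_pMn2r _ 2) // -[leRHS]mulrnAr -energy.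
  exact: (@pointwise_poincare s f x0 e_sym e_irr (conn x0) us).
have l_ge0 : 0 <= l.
  rewrite -lecR; apply: (laplacian_eigenvalue_ge0 e_sym ms).
  by apply/laplacian_eigenvalueP; exists f.
have mass : \sum_x nf x ^+ 2 <= #|V|%:R * nf x0 ^+ 2.
  rewrite mulr_natl -sumr_const; apply: ler_sum => x _.
  by rewrite ler_pXn2r ?nnegrE.
have K_gt0 : 0 < (diam e)%:R + 1 :> R by rewrite ltr_wpDl.
rewrite ler_pdivrMr ?mulr_gt0 ?ltr0n // -(@ler_pM2r _ (nf x0 ^+ 2)) ?exprn_gt0 //.
rewrite mul1r; apply: le_trans low _; rewrite [l * (_ * _)]mulrCA -!mulrA.
by rewrite ler_pM2l // ler_wpM2l.
Qed.

End Walks.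

Theorem proposition3p12 (R : realType) (V : finType) (e : rel V)
    (e_sym : symmetric e) (e_irr : irreflexive e)
    (e_conn : connected_graph e) :
  ((exists s : V -> V -> R[i], unbalanced_signature e s) ->
     (magneto_spectral_height R e >= inf_lambda1_unbalanced R e)%E) /\
  (inf_lambda1_unbalanced R e >=
     (1 / (((diam e)%:R + 1) * #|V|%:R))%:E)%E.
Proof.
split=> [[s us]|].
  apply: (@le_trans _ _ (lambda1 e s)%:E).
    by apply: ereal_inf_lbound; exists s.
  by apply: ereal_sup_ubound; exists s => //; case: us => -[].
apply: le_ereal_inf_tmp => _ [s us <-]; rewrite lee_fin.
exact: lambda1_unbalanced_ge.
Qed.
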